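(* Let $G$ be a discrete countable group and let $\lambda$ be a probability measure on $G$ with finite support. If $G$ is amenable, then $I_\lambda(G)=0$. Namely, on any amenable group there are KL-almost invariant measures: for every finite $S\subset G$ and every $\epsilon>0$ there is a fully supported probability measure $\eta$ on $G$ such that $D_{KL}(g\eta\|\eta)<\epsilon$ for all $g\in S$.
   Context: For probability measures $m,\nu$ in the same measure class on a measurable space $X$, $D_{KL}(m\|\nu):=\int_X -\ln\left(\frac{d\nu}{dm}\right)dm\in[0,\infty]$. The group $G$ acts on itself by left translation, and for a probability measure $\eta$ on $G$, $g\eta$ is the push-forward, i.e. $(g\eta)(x)=\eta(g^{-1}x)$. For a fully supported probability measure $\eta$ on $G$ the Furstenberg entropy is $h_\lambda(G,\eta):=\sum_{g\in G}\lambda(g)D_{KL}(g\eta\|\eta)$, and $I_\lambda(G):=\inf_\eta h_\lambda(G,\eta)$, where the infimum is over all fully supported probability measures $\eta$ on $G$. *)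

(* Defs.v *)
From HB Require Import structures.
From mathcomp Require Import all_boot all_order all_algebra.
From mathcomp Require Import all_classical all_reals all_analysis.
Set Implicit Arguments.
Unset Strict Implicit.
Unset Printing Implicit Defensive.
Import Order.TTheory GRing.Theory Num.Theory.
Import numFieldNormedType.Exports.
Local Open Scope classical_set_scope.
Local Open Scope ring_scope.

(* A copy of the carrier of [G] whose sigma-algebra consists of all subsets. *)
Definition discrete_group (G : groupType) : Type := G.

Section discrete_group_instances.
Variable G : groupType.

HB.instance Definition _ := Group.on (discrete_group G).
HB.instance Definition _ := isPointed.Build (discrete_group G) (1%g : G).
HB.instance Definition _ := @isMeasurable.Build default_measure_display
  (discrete_group G) (@discrete_measurable _) (@discrete_measurable0 _)
  (@discrete_measurableC _) (@discrete_measurableU _).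

End discrete_group_instances.

Section left_translation.
Variable G : groupType.

Definition left_translation (g x : discrete_group G) : discrete_group G :=
  (g * x)%g.

Let measurable_left_translation (g : discrete_group G) :
  measurable_fun [set: discrete_group G] (left_translation g).
Proof. by []. Qed.

HB.instance Definition _ (g : discrete_group G) :=
  isMeasurableFun.Build _ _ _ _ (left_translation g)
    (measurable_left_translation g).

End left_translation.

(* The measure [g eta], with [(g eta)(A) = eta (g^-1 A)]. *)
Definition translate (R : realType) (G : groupType) (g : discrete_group G)
    (eta : probability (discrete_group G) R)
    : probability (discrete_group G) R :=
  distribution eta (left_translation g).

(* [lne] is the extended logarithm, with [lne 0 = -oo]. The formula is meant
   for [m] and [nu] in the same measure class; the negative part of the
   integrand is then [m]-integrable, so the integral is a genuine element of
   [[0, +oo]]. *)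
Definition DKL d (T : measurableType d) (R : realType)
    (m nu : probability T R) : \bar R :=
  (\int[m]_x (- lne (Radon_Nikodym (charge_of_finite_measure nu) m x)))%E.

Section furstenberg_entropy.
Variables (R : realType) (G : groupType).
Implicit Types lambda eta : probability (discrete_group G) R.

Definition finitely_supported lambda : Prop :=
  finite_set [set g : discrete_group G | lambda [set g] != 0%E].

Definition fully_supported eta : Prop :=
  forall g : discrete_group G, (0 < eta [set g])%E.

(* In [\bar R], [0 * +oo = 0], so only the support of [lambda] matters. *)
Definition furstenberg_entropy lambda eta : \bar R :=
  (\esum_(g in [set: discrete_group G])
     (lambda [set g] * DKL (translate g eta) eta))%E.

Definition inf_furstenberg_entropy lambda : \bar R :=
  ereal_inf [set furstenberg_entropy lambda eta | eta in fully_supported].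

End furstenberg_entropy.

(* Means are functionals on the bounded functions; the value of [M] on an
   unbounded function is unconstrained. *)
Record left_invariant_mean (R : realType) (G : groupType)
    (M : (G -> R) -> R) : Prop := {
  mean_linear : forall (a : R) (f h : G -> R),
    bounded_fun f -> bounded_fun h ->
    M (fun x => a * f x + h x) = a * M f + M h ;
  mean_ge0 : forall f : G -> R,
    bounded_fun f -> (forall x, 0 <= f x) -> 0 <= M f ;
  mean_cst1 : M (fun=> 1) = 1 ;
  mean_invariant : forall (g : G) (f : G -> R),
    bounded_fun f -> M (fun x => f (g^-1 * x)%g) = M f
}.

Definition amenable (R : realType) (G : groupType) : Prop :=
  exists M : (G -> R) -> R, left_invariant_mean M.

(* Main.v *)
(* Day's argument turns an invariant mean into a positive summable z with
   sum_i ||s_i z - z||_1 < d ||z||_1, where s enumerates the given finite set: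
   otherwise Hahn-Banach separates the vectors (s_i z - z)_i from 0 by bounded
   functions f_i with sum_i (f_i(s_i x) - f_i(x)) >= d for all x, and applying
   the mean gives 0 >= d.  Small l^1 displacement alone does not control D_KL,
   so z is replaced by w = sum_n 2^-(n+1) T^n z, where T averages over the k
   translates by the s_i.  Then s_i w <= 2 k w, while
   ||s_i T^n z - T^n z||_1 <= (2n+1) d ||z||_1 keeps ||s_i w - w||_1 small.
   Finally, for probabilities with m <= C nu, the inequality ln t <= t - 1
   gives D_KL(m || nu) <= C ||m - nu||_1. *)

Require Import Defs.
From HB Require Import structures.
From mathcomp Require Import all_boot all_order all_algebra.
From mathcomp Require Import all_classical all_reals all_analysis.
From mathcomp Require Import ring lra.
Set Implicit Arguments.
Unset Strict Implicit.
Unset Printing Implicit Defensive.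
Import Order.TTheory GRing.Theory Num.Theory.
Local Open Scope classical_set_scope.
Local Open Scope ring_scope.

(** * The Hahn-Banach theorem on a linear subspace [P] *)

Section hahn_banach.
Variables (R : realType) (V : lmodType R) (P : set V).
Hypothesis P0 : P 0.
Hypothesis PD : forall x y, P x -> P y -> P (x + y).
Hypothesis PZ : forall t x, P x -> P (t *: x).
Implicit Types p q : V -> R.

(** Applying the homogeneity inequality to [t^-1] turns it into an equality on a subspace; the
    inequality is the form that infima inherit directly. *)
Definition sublinear_on p :=
  (forall x y, P x -> P y -> p (x + y) <= p x + p y) /\
  (forall t x, 0 < t -> P x -> p (t *: x) <= t * p x).

Lemma sublinear_on0 p : sublinear_on p -> p 0 = 0.
Proof.
move=> [pD pZ]; have := pD _ _ P0 P0; have := @pZ 2^-1 0 _ P0.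
rewrite scaler0 addr0 => /(_ ltac:(by rewrite invr_gt0)); lra.
Qed.

Lemma sublinear_on_geN p x : sublinear_on p -> P x -> - p (- x) <= p x.
Proof.
move=> sp Px; have PNx : P (- x) by rewrite -scaleN1r; exact: PZ.
have := sp.1 _ _ Px PNx; rewrite subrr (sublinear_on0 sp); lra.
Qed.

(** The lower bound [b] keeps every [inf] genuine rather than a default value. Letting the index [k]
    vary covers chains of functionals, the half-line of parameters [t], and the cone of vectors [z]
    in Day's argument. *)
Lemma sublinear_on_inf (I : Type) (A : set I) (p : I -> V -> R) (b : V -> R) :
  A !=set0 ->
  (forall x i, P x -> A i -> b x <= p i x) ->
  (forall x y i j, P x -> P y -> A i -> A j ->
    exists2 k, A k & p k (x + y) <= p i x + p j y) ->
  (forall t x i, 0 < t -> P x -> A i ->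
    exists2 k, A k & p k (t *: x) <= t * p i x) ->
  sublinear_on (fun x => inf [set p i x | i in A]).
Proof.
move=> [i0 Ai0] bp pD pZ.
have ne x : [set p i x | i in A] !=set0 by exists (p i0 x), i0.
have inf_le x i : P x -> A i -> inf [set p i x | i in A] <= p i x.
  move=> Px Ai; apply: ge_inf; last by exists i.
  by exists (b x) => _ [j Aj <-]; exact: bp.
split=> [x y Px Py|t x t0 Px].
  rewrite -lerBlDr; apply: lb_le_inf => // _ [i Ai <-].
  rewrite lerBlDr -lerBlDl; apply: lb_le_inf => // _ [j Aj <-].
  rewrite lerBlDl; have [k Ak] := pD x y i j Px Py Ai Aj.
  by apply: le_trans; apply: inf_le => //; exact: PD.
rewrite mulrC -ler_pdivrMr//; apply: lb_le_inf => // _ [i Ai <-].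
rewrite ler_pdivrMr// mulrC; have [k Ak] := pZ t x i t0 Px Ai.
by apply: le_trans; apply: inf_le => //; exact: PZ.
Qed.

(* A sublinear functional that is minimal among those below [q] is additive:
   otherwise [x |-> inf_(t >= 0) (p (x + t y) - t p y)] would be smaller. *)
Lemma hahn_banach q : sublinear_on q ->
  exists p, [/\ forall x, P x -> p x <= q x,
    forall x y, P x -> P y -> p (x + y) = p x + p y &
    forall x, P x -> p (- x) = - p x].
Proof.
move=> sq.
pose T := {p | sublinear_on p /\ forall x, P x -> p x <= q x}.
(* The order is reversed: a maximal element for [le] is a minimal functional. *)
pose le (p p' : T) := `[< forall x, P x -> sval p' x <= sval p x >].
pose q0 : T := exist _ q (conj sq (fun x _ => lexx (q x))).
(* A lower bound common to all functionals below [q], so infima over chains are finite. *)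
have geNq (p : T) x : P x -> - q (- x) <= sval p x.
  move=> Px; apply: le_trans (sublinear_on_geN (svalP p).1 Px).
  by rewrite lerN2; apply: (svalP p).2; rewrite -scaleN1r; exact: PZ.
have [||A totA|[p [sp pq]] minp] := @ZL_preorder T q0 le.
- by move=> p; apply/asboolP.
- move=> p1 p2 p3 /asboolP h1 /asboolP h2; apply/asboolP => x Px.
  exact: le_trans (h2 _ Px) (h1 _ Px).
- have [A0|/set0P A0] := eqVneq A set0.
    by exists q0 => s; rewrite A0.
  have sinf : sublinear_on (fun x => inf [set sval p x | p in A]).
    apply: (@sublinear_on_inf _ _ _ (fun x => - q (- x))) => //.
    + by move=> x p Px _; exact: geNq.
    + move=> x y p1 p2 Px Py A1 A2.
      have [/asboolP le12|/asboolP le21] := totA _ _ A1 A2.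
        exists p2 => //; apply: le_trans ((svalP p2).1.1 _ _ Px Py) _.
        by rewrite lerD2r; exact: le12.
      exists p1 => //; apply: le_trans ((svalP p1).1.1 _ _ Px Py) _.
      by rewrite lerD2l; exact: le21.
    + by move=> t x p t0 Px Ap; exists p => //; exact: (svalP p).1.2.
  have infle (p : T) x : A p -> P x -> inf [set sval p x | p in A] <= sval p x.
    move=> Ap Px; apply: ge_inf; last by exists p.
    by exists (- q (- x)) => _ [p' _ <-]; exact: geNq.
  have infq x : P x -> inf [set sval p x | p in A] <= q x.
    move=> Px; have [p Ap] := A0.
    exact: le_trans (infle _ _ Ap Px) ((svalP p).2 _ Px).
  pose pinf : T := exist _ (fun x => inf [set sval p x | p in A])
    (conj sinf infq).
  exists pinf => p Ap; apply/asboolP => x Px /=.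
  exact: infle.
have PN x : P x -> P (- x) by rewrite -scaleN1r; exact: PZ.
have pD x y : P x -> P y -> p (x + y) = p x + p y.
  move=> Px Py; apply/eqP; rewrite eq_le sp.1//=.
  pose py x := inf [set p (x + t *: y) - t * p y | t in [set t | 0 <= t]].
  (* Subadditivity gives [p (t *: y) <= p (x' + t *: y) + p (- x')], and homogeneity at [t^-1] gives
     [t * p y <= p (t *: y)]. *)
  have pyge x' t : P x' -> 0 <= t -> - p (- x') <= p (x' + t *: y) - t * p y.
    rewrite le_eqVlt => Px' /predU1P[<-|t0].
      by rewrite scale0r addr0 mul0r subr0; exact: sublinear_on_geN.
    have Pt : P (t *: y) by exact: PZ.
    have := sp.1 _ _ (PD Px' Pt) (PN _ Px').
    rewrite addrAC subrr add0r.
    have := @sp.2 t^-1 _ ltac:(by rewrite invr_gt0) Pt.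
    rewrite scalerK ?gt_eqF// mulrC ler_pdivlMr//; lra.
  have pyle x' t : P x' -> 0 <= t -> py x' <= p (x' + t *: y) - t * p y.
    move=> Px' t0; apply: ge_inf; last by exists t.
    by exists (- p (- x')) => _ [t' t'0 <-]; exact: pyge.
  have spy : sublinear_on py.
    apply: (@sublinear_on_inf _ _ _ (fun x => - p (- x))).
    - by exists 0 => /=.
    - by move=> x' t Px' t0; exact: pyge.
    - move=> x1 x2 t1 t2 Px1 Px2 /= t10 t20; exists (t1 + t2).
        exact: addr_ge0.
      have := sp.1 _ _ (PD Px1 (PZ t1 Py)) (PD Px2 (PZ t2 Py)).
      by rewrite scalerDl addrACA; lra.
    - move=> s x1 t s0 Px1 /= t0; exists (s * t).
        by rewrite mulr_ge0// ltW.
      have := sp.2 s _ s0 (PD Px1 (PZ t Py)).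
      by rewrite scalerDr scalerA; lra.
  have pyp x' : P x' -> py x' <= p x'.
    move=> Px'; have := pyle _ _ Px' (lexx 0).
    by rewrite scale0r addr0 mul0r subr0.
  have pyq x' : P x' -> py x' <= q x'.
    by move=> Px'; exact: le_trans (pyp _ Px') (pq _ Px').
  (* Minimality gives [p x <= py x], while [t = 1] gives [py x <= p (x + y) - p y]. *)
  have /asboolP/(_ _ Px)/= :=
    minp (exist _ py (conj spy pyq)) ltac:(exact/asboolP).
  by have := pyle _ _ Px ler01; rewrite scale1r mul1r; lra.
exists p; split=> // x Px; have := pD _ _ Px (PN _ Px).
by rewrite subrr (sublinear_on0 sp); lra.
Qed.

End hahn_banach.

(** * Unordered sums of nonnegative extended reals *)

Section esum_extra.
Variable R : realType.
Local Open Scope ereal_scope.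

(** One inequality comes from finite subsums; the other is the same inequality for the factor
    [c^-1], with [c = 0] treated apart. *)
Lemma esumZl (T : choiceType) (c : R) (a : T -> \bar R) :
  (0 <= c)%R -> (forall x, 0 <= a x) ->
  \esum_(x in setT) (c%:E * a x) = c%:E * \esum_(x in setT) a x.
Proof.
move=> c0 a0; have le (d : R) (b : T -> \bar R) : (0 <= d)%R ->
    (forall x, 0 <= b x) ->
    \esum_(x in setT) (d%:E * b x) <= d%:E * \esum_(x in setT) b x.
  move=> d0 b0; apply: ge_ereal_sup => /= _ [X [finX _] <-].
  rewrite -ge0_mule_fsumr//; apply: lee_pmul => //.
  - by rewrite fsume_ge0.
  - by apply: ereal_sup_ubound; exists X.
apply/eqP; rewrite eq_le le//=.
have [->|cn0] := eqVneq c 0%R.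
  by rewrite mul0e esum_ge0// => x _; rewrite mul0e.
have {cn0}c0 : (0 < c)%R by rewrite lt0r cn0.
rewrite muleC -lee_pdivlMr// muleC.
have := le c^-1%R (fun x => c%:E * a x) ltac:(by rewrite invr_ge0 ltW).
under eq_esum do rewrite muleA -EFinM mulVf ?gt_eqF// mul1e.
by apply=> x; rewrite mule_ge0// lee_fin ltW.
Qed.

Lemma esum_exchange (T1 T2 : choiceType) (a : T1 -> T2 -> \bar R) :
  (forall x y, 0 <= a x y) ->
  \esum_(x in setT) \esum_(y in setT) a x y =
  \esum_(y in setT) \esum_(x in setT) a x y.
Proof.
move=> a0; rewrite !esum_esum//.
have setXT (A B : Type) : [set: A] `*`` (fun=> [set: B]) = setT.
  by apply/seteqP; split.
rewrite !setXT.
rewrite (reindex_esum [set: T1 * T2] [set: T2 * T1] (fun x => (x.2, x.1)))//.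
split=> //= [[x y] [x' y'] _ _ [-> ->]//|[x y] _].
by exists (y, x).
Qed.

Lemma le_esum_inj (T1 T2 : choiceType) (e : T1 -> T2) (a : T2 -> \bar R) :
  injective e -> (forall y, 0 <= a y) ->
  \esum_(x in setT) a (e x) <= \esum_(y in setT) a y.
Proof.
move=> injE a0; rewrite -esum_image//; last by move=> ? ? _ _ /injE.
rewrite esum_mkcond; apply: le_esum => y _; case: ifP => // _; exact: a0.
Qed.

Lemma esum_ge_term (T : choiceType) (a : T -> \bar R) x :
  (forall y, 0 <= a y) -> a x <= \esum_(y in setT) a y.
Proof.
move=> a0; rewrite -(esum_set1 (t := x))// esum_mkcond.
by apply: le_esum => y _; case: ifP => // _; exact: a0.
Qed.

Lemma esum_nat_le (a : nat -> R) (c : R) : (forall n, 0 <= a n)%R ->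
  (forall n, \sum_(0 <= i < n) a i <= c)%R ->
  \esum_(n in setT) (a n)%:E <= c%:E.
Proof.
move=> a0 ac; rewrite -nneseries_esumT; last by move=> n; rewrite lee_fin.
apply: lime_le; first by apply: is_cvg_nneseries => n _ _; rewrite lee_fin.
by apply: nearW => n; rewrite sumEFin lee_fin.
Qed.

End esum_extra.

(** * Summable functions and the l^1 norm *)

Section l1norm.
Variables (R : realType) (T : choiceType).
Implicit Types u v : T -> R.

Definition summable1 u := (\esum_(x in setT) `|u x|%:E < +oo)%E.

(** When the sum is [+oo], [fine] returns 0, so the norm estimates carry summability hypotheses. *)
Definition norm1 u : R := fine (\esum_(x in setT) `|u x|%:E).

Lemma esum_norm_ge0 u : (0 <= \esum_(x in setT) `|u x|%:E)%E.
Proof. by apply: esum_ge0 => x _; rewrite lee_fin. Qed.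

Lemma norm1E u : summable1 u -> (\esum_(x in setT) `|u x|%:E = (norm1 u)%:E)%E.
Proof. by move=> su; rewrite fineK// ge0_fin_numE// esum_norm_ge0. Qed.

Lemma norm1_ge0 u : 0 <= norm1 u.
Proof. by rewrite fine_ge0// esum_norm_ge0. Qed.

Lemma norm1_gt0 u x : summable1 u -> u x != 0 -> 0 < norm1 u.
Proof.
move=> su ux; rewrite -lte_fin -norm1E//; apply: (@lt_le_trans _ _ `|u x|%:E).
  by rewrite lte_fin normr_gt0.
by apply: (@esum_ge_term _ _ (fun x => `|u x|%:E)) => y; rewrite lee_fin.
Qed.

Lemma le_norm1 u v : (forall x, `|u x| <= `|v x|) -> summable1 v ->
  summable1 u /\ norm1 u <= norm1 v.
Proof.
move=> uv sv; have le : (\esum_(x in setT) `|u x|%:E <= (norm1 v)%:E)%E.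
  by rewrite -norm1E//; apply: le_esum => x _; rewrite lee_fin.
have su : summable1 u by rewrite /summable1 (le_lt_trans le)// ltry.
by split=> //; move: le; rewrite norm1E// lee_fin.
Qed.

Lemma esum_normD u v :
  (\esum_(x in setT) `|(u + v) x|%:E <=
   \esum_(x in setT) `|u x|%:E + \esum_(x in setT) `|v x|%:E)%E.
Proof.
rewrite -esumD//; do ?by move=> x _; rewrite lee_fin.
by apply: le_esum => x _; rewrite -EFinD lee_fin ler_normD.
Qed.

Lemma summable1D u v : summable1 u -> summable1 v -> summable1 (u + v).
Proof.
move=> su sv; rewrite /summable1 (le_lt_trans (esum_normD u v))//.
exact: lte_add_pinfty.
Qed.

Lemma ler_norm1D u v : summable1 u -> summable1 v ->
  norm1 (u + v) <= norm1 u + norm1 v.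
Proof.
move=> su sv; have := esum_normD u v.
by rewrite !norm1E// ?lee_fin//; exact: summable1D.
Qed.

(** Makes [d * norm1 z] additive on the cone of nonnegative vectors, so that subtracting it
    preserves subadditivity in Day's argument. *)
Lemma norm1D u v : (forall x, 0 <= u x) -> (forall x, 0 <= v x) ->
  summable1 u -> summable1 v -> norm1 (u + v) = norm1 u + norm1 v.
Proof.
move=> u0 v0 su sv; apply: EFin_inj; rewrite EFinD -!norm1E//; last first.
  exact: summable1D.
rewrite -esumD//; do ?by move=> x _; rewrite lee_fin.
by apply: eq_esum => x _; rewrite !ger0_norm// addr_ge0.
Qed.

Lemma esum_normZ t u : (\esum_(x in setT) `|(t *: u) x|%:E =
  `|t|%:E * \esum_(x in setT) `|u x|%:E)%E.
Proof.
by rewrite -esumZl//; apply: eq_esum => x _; rewrite -EFinM -normrM.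
Qed.

Lemma summable1Z t u : summable1 u -> summable1 (t *: u).
Proof. by move=> su; rewrite /summable1 esum_normZ norm1E// -EFinM ltry. Qed.

Lemma norm1Z t u : summable1 u -> norm1 (t *: u) = `|t| * norm1 u.
Proof.
move=> su; apply: EFin_inj; rewrite -norm1E ?esum_normZ ?norm1E//.
exact: summable1Z.
Qed.

Lemma summable1N u : summable1 u -> summable1 (- u).
Proof. by rewrite -scaleN1r; exact: summable1Z. Qed.

Lemma norm1N u : summable1 u -> norm1 (- u) = norm1 u.
Proof. by move=> su; rewrite -scaleN1r norm1Z// normrN1 mul1r. Qed.

Lemma summable1B u v : summable1 u -> summable1 v -> summable1 (u - v).
Proof. by move=> su sv; apply: summable1D => //; exact: summable1N. Qed.

Lemma ler_norm1B u v : summable1 u -> summable1 v ->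
  norm1 (u - v) <= norm1 u + norm1 v.
Proof.
by move=> su sv; rewrite -(norm1N sv) ler_norm1D//; exact: summable1N.
Qed.

Lemma esum_norm0 : (\esum_(x in setT) `|(0 : T -> R) x|%:E = 0)%E.
Proof. by apply: esum1 => x _; rewrite normr0. Qed.

Lemma summable10 : summable1 0.
Proof. by rewrite /summable1 esum_norm0. Qed.

Lemma norm10 : norm1 0 = 0.
Proof. by rewrite /norm1 esum_norm0. Qed.

Definition point_mass (x : T) : T -> R := fun y => (y == x)%:R.

Lemma esum_point_mass x : (\esum_(y in setT) `|point_mass x y|%:E = 1)%E.
Proof.
transitivity (\esum_(y in [set x]) (1 : \bar R))%E; last by rewrite esum_set1.
rewrite [RHS]esum_mkcond; apply: eq_esum => y _; rewrite /point_mass.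
have [->|yx] := eqVneq y x; first by rewrite mem_set// normr1.
by rewrite memNset ?normr0//; exact/eqP.
Qed.

Lemma summable1_point_mass x : summable1 (point_mass x).
Proof. by rewrite /summable1 esum_point_mass ltry. Qed.

Lemma norm1_point_mass x : norm1 (point_mass x) = 1.
Proof. by rewrite /norm1 esum_point_mass. Qed.

Lemma esum_norm_bij (e : T -> T) u : bijective e ->
  (\esum_(x in setT) `|u (e x)|%:E = \esum_(x in setT) `|u x|%:E)%E.
Proof.
move=> be; rewrite (reindex_esum setT setT e (fun x => `|u x|%:E))//.
by rewrite setTT_bijective.
Qed.

End l1norm.

(** * Consequences of a left-invariant mean *)

Section left_invariant_mean_theory.
Variables (R : realType) (G : groupType) (M : (G -> R) -> R).
Hypothesis lim : left_invariant_mean M.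

Lemma bounded_fun_exP (f : G -> R) :
  bounded_fun f <-> exists C, forall x, `|f x| <= C.
Proof.
split=> [[C [_ bC]]|[C bC]].
  by exists (C + 1) => x; apply: bC => //; rewrite ltrDl.
exists C; split; first exact: num_real.
by move=> D CD x _; exact: le_trans (bC x) (ltW CD).
Qed.

Lemma bounded_fun_affine (a : R) (f h : G -> R) :
  bounded_fun f -> bounded_fun h -> bounded_fun (fun x => a * f x + h x).
Proof.
move=> /bounded_fun_exP[C bC] /bounded_fun_exP[D bD]; apply/bounded_fun_exP.
exists (`|a| * C + D) => x; apply: le_trans (ler_normD _ _) _.
by rewrite normrM lerD// ler_wpM2l.
Qed.

Lemma bounded_fun_cst (a : R) : bounded_fun (fun _ : G => a).
Proof. by apply/bounded_fun_exP; exists `|a|. Qed.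

Lemma mean_cst (a : R) : M (fun=> a) = a.
Proof.
have b1 := bounded_fun_cst 1.
have M0 : M (fun=> 0) = 0.
  have := mean_linear lim (-1) b1 b1; rewrite mean_cst1// mulr1 addNr => E.
  rewrite -[RHS]E.
  by congr M; apply/funext => x /=; rewrite mulr1 addNr.
have := mean_linear lim a b1 (bounded_fun_cst 0).
rewrite mean_cst1// M0 mulr1 addr0 => E; rewrite -[RHS]E.
by congr M; apply/funext => x /=; rewrite mulr1 addr0.
Qed.

Lemma mean_translateB (g : G) (f : G -> R) : bounded_fun f ->
  bounded_fun (fun x => f (g * x)%g - f x) /\
  M (fun x => f (g * x)%g - f x) = 0.
Proof.
move=> bf; have bgf : bounded_fun (fun x => f (g * x)%g).
  move/bounded_fun_exP : bf => [C bC]; apply/bounded_fun_exP; exists C => x.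
  exact: bC.
have E : (fun x => f (g * x)%g - f x) = (fun x => -1 * f x + f (g * x)%g).
  by apply/funext => x; rewrite mulN1r addrC.
rewrite E; split; first exact: bounded_fun_affine.
rewrite mean_linear//; have := mean_invariant lim (g^-1)%g bf.
by rewrite invgK => ->; rewrite mulN1r addNr.
Qed.

Lemma mean_sum_eq0 (I : Type) (r : seq I) (f : I -> G -> R) :
  (forall i, bounded_fun (f i) /\ M (f i) = 0) ->
  bounded_fun (fun x => \sum_(i <- r) f i x) /\
  M (fun x => \sum_(i <- r) f i x) = 0.
Proof.
move=> bf; elim: r => [|i r [br Mr]].
  have -> : (fun x => \sum_(i <- [::]) f i x) = (fun=> 0).
    by apply/funext => x; rewrite big_nil.
  by split; [exact: bounded_fun_cst|exact: mean_cst].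
have -> : (fun x => \sum_(j <- i :: r) f j x) =
    (fun x => 1 * f i x + \sum_(j <- r) f j x).
  by apply/funext => x; rewrite big_cons mul1r.
have [bi Mi] := bf i; split; first exact: bounded_fun_affine.
by rewrite mean_linear// Mr Mi mulr0 addr0.
Qed.

(** Each difference [f i (s i * x) - f i x] has mean zero; if their sum were at least [d]
    everywhere, positivity of the mean would give [0 >= d]. *)
Lemma mean_translate_lt (I : Type) (r : seq I) (s : I -> G) (f : I -> G -> R)
    (d : R) : (forall i, bounded_fun (f i)) -> 0 < d ->
  exists x, \sum_(i <- r) (f i (s i * x)%g - f i x) < d.
Proof.
move=> bf d0; apply: contrapT => /forallNP h.
have [b Ms] := mean_sum_eq0 r (fun i => mean_translateB (s i) (bf i)).
have bd := bounded_fun_cst (- d).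
have := mean_ge0 lim (bounded_fun_affine 1 b bd); rewrite mean_linear// Ms.
rewrite mean_cst mulr0 add0r => le0.
suff : 0 <= - d by rewrite oppr_ge0 leNgt d0.
by apply: le0 => x; rewrite mul1r subr_ge0 leNgt; exact/negP/h.
Qed.

End left_invariant_mean_theory.

(** * Left translation on l^1 *)

Section translation_norm.
Variables (R : realType) (G : groupType).
Implicit Types (u : G -> R) (g : G).

(** The action on weights that corresponds to [translate] on measures. *)
Definition ltrans g u : G -> R := fun x => u (g^-1 * x)%g.

Lemma esum_norm_ltrans g u :
  (\esum_(x in setT) `|ltrans g u x|%:E = \esum_(x in setT) `|u x|%:E)%E.
Proof.
apply: (@esum_norm_bij _ _ (fun x => g^-1 * x)%g u).
by exists (fun x => g * x)%g => x; rewrite ?mulKg ?mulVKg.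
Qed.

Lemma summable1_ltrans g u : summable1 u -> summable1 (ltrans g u).
Proof. by rewrite /summable1 esum_norm_ltrans. Qed.

Lemma norm1_ltrans g u : norm1 (ltrans g u) = norm1 u.
Proof. by rewrite /norm1 esum_norm_ltrans. Qed.

Lemma ltransD g u v : ltrans g (u + v) = ltrans g u + ltrans g v.
Proof. by []. Qed.

Lemma ltransZ g t u : ltrans g (t *: u) = t *: ltrans g u.
Proof. by []. Qed.

Lemma ltrans_point_mass g x :
  ltrans g (point_mass R x) = point_mass R (g * x)%g.
Proof.
apply/funext => y.
by rewrite /ltrans /point_mass (can2_eq (mulVKg g) (mulKg g)).
Qed.

End translation_norm.

(** * Day's argument: from an invariant mean to almost invariant l^1 vectors *)

Section reiter.
Variables (R : realType) (G : groupType) (I : finType) (s : I -> G).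
Implicit Types (w : I -> G -> R) (z : G -> R).

Definition summable_family w := forall i, summable1 (w i).

Definition norm_family w := \sum_i norm1 (w i).

Definition displacement z : I -> G -> R := fun i => ltrans (s i) z - z.

Lemma displacementD z1 z2 :
  displacement (z1 + z2) = displacement z1 + displacement z2.
Proof.
by apply/funext => i; rewrite /displacement ltransD opprD addrACA.
Qed.

Lemma displacementZ t z : displacement (t *: z) = t *: displacement z.
Proof. by apply/funext => i; rewrite /displacement ltransZ -scalerBr. Qed.

Lemma displacement0 : displacement 0 = 0.
Proof. by rewrite -[X in displacement X](scale0r 0) displacementZ scale0r. Qed.

Lemma summable_displacement z :
  summable1 z -> summable_family (displacement z).
Proof. by move=> sz i; apply: summable1B => //; exact: summable1_ltrans. Qed.

Lemma summable_familyD w1 w2 :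
  summable_family w1 -> summable_family w2 -> summable_family (w1 + w2).
Proof. by move=> s1 s2 i; exact: summable1D. Qed.

Lemma summable_familyZ t w : summable_family w -> summable_family (t *: w).
Proof. by move=> sw i; exact: summable1Z. Qed.

Lemma summable_familyN w : summable_family w -> summable_family (- w).
Proof. by move=> sw i; exact: summable1N. Qed.

Lemma summable_family0 : summable_family 0.
Proof. by move=> i; exact: summable10. Qed.

Lemma norm_familyD w1 w2 : summable_family w1 -> summable_family w2 ->
  norm_family (w1 + w2) <= norm_family w1 + norm_family w2.
Proof.
by move=> s1 s2; rewrite -big_split/=; apply: ler_sum => i _; exact: ler_norm1D.
Qed.

Lemma norm_familyZ t w : summable_family w ->
  norm_family (t *: w) = `|t| * norm_family w.
Proof.
by move=> sw; rewrite mulr_sumr; apply: eq_bigr => i _; exact: norm1Z.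
Qed.

Lemma norm_familyN w : summable_family w -> norm_family (- w) = norm_family w.
Proof. by move=> sw; rewrite -scaleN1r norm_familyZ// normrN1 mul1r. Qed.

(** The coordinate vectors of the [I]-fold l^1 sum. The values of a functional on them are the
    bounded functions to which the mean is applied. *)
Definition unit_family i x : I -> G -> R :=
  fun j => if j == i then point_mass R x else 0.

Lemma summable_unit_family i x : summable_family (unit_family i x).
Proof.
move=> j; rewrite /unit_family; case: ifP => _; last exact: summable10.
exact: summable1_point_mass.
Qed.

Lemma norm_unit_family i x : norm_family (unit_family i x) = 1.
Proof.
rewrite /norm_family (bigD1 i)//= /unit_family eqxx norm1_point_mass.
rewrite big1 ?addr0// => j /negbTE ->; exact: norm10.
Qed.

(** Translating a point mass moves its point, so a linear functional evaluated here becomes a sum of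
    differences [f i (s i * x) - f i x]. *)
Lemma displacement_point_mass x : displacement (point_mass R x) =
  \sum_i (unit_family i (s i * x)%g - unit_family i x).
Proof.
apply/funext => j; rewrite fct_sumE (bigD1 j)//= big1 ?addr0 => [|i ij].
  transitivity (unit_family j (s j * x)%g j - unit_family j x j) => //.
  by rewrite /unit_family eqxx /displacement ltrans_point_mass.
transitivity (unit_family i (s i * x)%g j - unit_family i x j) => //.
by rewrite /unit_family eq_sym (negbTE ij) subr0.
Qed.

Lemma reiter (d : R) : amenable R G -> 0 < d -> exists z,
  [/\ forall x, 0 <= z x, summable1 z &
    norm_family (displacement z) < d * norm1 z].
Proof.
move=> [M limM] d0; apply: contrapT => /forallNP noz.
pose Z : set (G -> R) := [set z | (forall x, 0 <= z x) /\ summable1 z].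
have dZ z : Z z -> d * norm1 z <= norm_family (displacement z).
  by move=> [z0 sz]; rewrite leNgt; apply/negP => lt; apply: (noz z).
have Z0 : Z 0 by split=> //; exact: summable10.
(* Separation is encoded in [q]: the choice [w = - displacement z] gives [q w <= - d * norm1 z], so
   a linear [phi <= q] satisfies [phi (displacement z) >= d * norm1 z] on [Z]. *)
pose F z w := norm_family (w + displacement z) - d * norm1 z.
pose q w := inf [set F z w | z in Z].
(* By the triangle inequality and [dZ], [norm_family (w + displacement z)] is at least
   [d * norm1 z - norm_family w]. *)
have Fge w z : summable_family w -> Z z -> - norm_family w <= F z w.
  move=> sw Zz; have sD := summable_displacement Zz.2.
  have := norm_familyD (summable_familyD sw sD) (summable_familyN sw).
  rewrite norm_familyN// addrAC subrr add0r; have := dZ _ Zz.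
  rewrite /F; lra.
have qle w z : summable_family w -> Z z -> q w <= F z w.
  move=> sw Zz; apply: ge_inf; last by exists z.
  by exists (- norm_family w) => _ [y Zy <-]; exact: Fge.
have sq : sublinear_on summable_family q.
  apply: (@sublinear_on_inf _ _ _ summable_familyD summable_familyZ _ Z F
    (fun w => - norm_family w)).
  - by exists 0.
  - by move=> w z; exact: Fge.
  - move=> w1 w2 z1 z2 sw1 sw2 [z10 sz1] [z20 sz2]; exists (z1 + z2).
      by split=> [x|]; [exact: addr_ge0|exact: summable1D].
    have sD1 := summable_displacement sz1.
    have sD2 := summable_displacement sz2.
    have := norm_familyD (summable_familyD sw1 sD1) (summable_familyD sw2 sD2).
    by rewrite /F displacementD norm1D// addrACA; lra.
  - move=> t w z t0 sw [z0 sz]; exists (t *: z).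
      by split=> [x|]; [rewrite mulr_ge0// ltW|exact: summable1Z].
    rewrite /F displacementZ -scalerDr norm_familyZ ?norm1Z ?gtr0_norm//.
      by rewrite mulrBr mulrCA.
    exact/summable_familyD/summable_displacement.
have [phi [phiq phiD phiN]] :=
  hahn_banach summable_family0 summable_familyD summable_familyZ sq.
(* The choice [z = 0] in the infimum bounds [phi] by the norm, which makes the functions [f i] below
   bounded. *)
have phile w : summable_family w -> phi w <= norm_family w.
  move=> sw; apply: le_trans (phiq _ sw) (le_trans (qle _ _ sw Z0) _).
  by rewrite /F displacement0 norm10 mulr0 subr0 addr0.
have phi0 : phi 0 = 0.
  have := phiD _ _ summable_family0 summable_family0; rewrite addr0; lra.
have phi_sum (r : seq I) (w : I -> I -> G -> R) :
    (forall i, summable_family (w i)) ->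
    summable_family (\sum_(i <- r) w i) /\
    phi (\sum_(i <- r) w i) = \sum_(i <- r) phi (w i).
  move=> sw; elim: r => [|i r [sr pr]].
    by rewrite !big_nil; split=> //; exact: summable_family0.
  by rewrite !big_cons phiD// pr; split=> //; exact: summable_familyD.
pose f i x := phi (unit_family i x).
have bf i : bounded_fun (f i).
  apply/bounded_fun_exP; exists 1 => x; have su := summable_unit_family i x.
  have := phile _ su; have := phile _ (summable_familyN su).
  rewrite norm_familyN// norm_unit_family phiN// -/(f i x) ler_norml; lra.
(* At this [x], [phi] of the displacement of the point mass is less than [d]; separation will force
   it to be at least [d], since a point mass has norm 1. *)
have [x] := mean_translate_lt limM (index_enum I) s bf d0.
have [_] := phi_sum (index_enum I)
  (fun i => unit_family i (s i * x)%g - unit_family i x)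
  (fun i => summable_familyD (summable_unit_family i (s i * x)%g)
     (summable_familyN (summable_unit_family i x))).
rewrite -displacement_point_mass.
under eq_bigr => i _.
  rewrite phiD ?phiN; [over|exact: summable_unit_family..|].
  exact/summable_familyN/summable_unit_family.
rewrite -/(f _) => <-; apply/negP; rewrite -leNgt.
have sx := summable1_point_mass R x.
have Zx : Z (point_mass R x) by split=> // y; rewrite ler0n.
have sD := summable_displacement sx.
have := phiq _ (summable_familyN sD); have := qle _ _ (summable_familyN sD) Zx.
rewrite phiN// /F addNr norm1_point_mass mulr1.
have -> : norm_family 0 = 0.
  by rewrite /norm_family big1// => i _; exact: norm10.
lra.
Qed.

End reiter.

(** * The weights 2^-(n+1) and their series *)

Section geometric_weights.
Variable R : realType.
Local Open Scope ereal_scope.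

Definition geo (n : nat) : R := (2^-1 ^+ n.+1)%R.

Lemma geo_gt0 n : (0 < geo n)%R.
Proof. by rewrite exprn_gt0// invr_gt0. Qed.

Lemma geoS n : (geo n = 2 * geo n.+1)%R.
Proof. by rewrite /geo [in RHS]exprS mulrA mulfV// mul1r. Qed.

Lemma esum_geo : \esum_(n in setT) (geo n)%:E <= 1.
Proof.
apply: esum_nat_le => [n|n]; first exact/ltW/geo_gt0.
suff -> : (\sum_(0 <= i < n) geo i = 1 - 2 * geo n)%R.
  by rewrite gerBl mulr_ge0// ltW// geo_gt0.
elim: n => [|n IH]; first by rewrite big_nil /geo expr1 mulfV// subrr.
by rewrite big_nat_recr//= IH (geoS n); ring.
Qed.

(** The factor [2 * n + 1] is the growth of the displacement after [n] averagings; 3 is the limit of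
    the closed form for the partial sums. *)
Lemma esum_geo_odd : \esum_(n in setT) (geo n * (2 * n%:R + 1))%:E <= 3%:E.
Proof.
apply: esum_nat_le => [n|n]; first by rewrite mulr_ge0// ltW// geo_gt0.
suff -> : (\sum_(0 <= i < n) geo i * (2 * i%:R + 1) =
    3 - 2 * geo n * (2 * n%:R + 3))%R.
  by rewrite gerBl !mulr_ge0// ltW// geo_gt0.
elim: n => [|n IH].
  by rewrite big_nil /geo expr1 mulfV// mulr0 add0r mul1r subrr.
by rewrite big_nat_recr//= IH (geoS n) -natr1; ring.
Qed.

(** Used to perturb a nonnegative vector into a strictly positive one. The geometric weights are
    pulled back along an injection into [nat]. *)
Lemma positive_summable (T : choiceType) : countable [set: T] ->
  exists p : T -> R, (forall x, 0 < p x)%R /\ summable1 p.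
Proof.
move=> /countable_injP[f injf]; exists (fun x => geo (f x)); split=> [x|].
  exact: geo_gt0.
rewrite /summable1; apply: (@le_lt_trans _ _ 1); last exact: ltry.
apply: le_trans esum_geo.
under eq_esum do rewrite gtr0_norm ?geo_gt0//.
apply: (@le_esum_inj _ _ _ f (fun n => (geo n)%:E)).
  by move=> x y; apply: injf; rewrite in_setT.
by move=> n; rewrite lee_fin ltW// geo_gt0.
Qed.

End geometric_weights.

(** * A positive weight that is both quasi-invariant and almost invariant *)

Section almost_invariant_weight.
Variables (R : realType) (G : groupType) (I : finType) (s : I -> G).
Hypothesis I0 : (0 < #|I|)%N.
Implicit Types (u z : G -> R).

Lemma reiter_pos (d : R) : countable [set: G] -> amenable R G -> 0 < d ->
  exists z, [/\ forall x, 0 < z x, summable1 z &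
    norm_family (displacement s z) < d * norm1 z].
Proof.
move=> cG amG d0; have [z [z0 sz dz]] := reiter s amG d0.
have [p [p0 sp]] := positive_summable R cG.
pose gap := d * norm1 z - norm_family (displacement s z).
have gap0 : 0 < gap by rewrite subr_gt0.
have N0 : 0 <= norm_family (displacement s p).
  by apply: sumr_ge0 => i _; exact: norm1_ge0.
have N1 : 0 < norm_family (displacement s p) + 1 by rewrite ltr_wpDl.
(* With this [t], the displacement of [t *: p] has norm less than the slack [gap] in the strict
   inequality; the [+ 1] keeps the denominator positive. *)
pose t := gap / (norm_family (displacement s p) + 1).
have t0 : 0 < t by rewrite divr_gt0.
have stp : summable1 (t *: p) by exact: summable1Z.
exists (z + t *: p); split.
- by move=> x; rewrite ltr_wpDl// mulr_gt0.
- exact: summable1D.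
have tp0 x : 0 <= (t *: p) x by rewrite mulr_ge0// ltW.
rewrite displacementD displacementZ norm1D// mulrDr.
have sdp := summable_displacement s sp.
apply: le_lt_trans (norm_familyD (summable_displacement s sz)
  (summable_familyZ t sdp)) _.
rewrite norm_familyZ// gtr0_norm//.
apply: (@lt_le_trans _ _ (d * norm1 z)); last first.
  by rewrite lerDl mulr_ge0 ?norm1_ge0// ltW.
by rewrite -ltrBrDl -/gap /t mulrAC ltr_pdivrMr// ltr_pM2l// ltrDl.
Qed.

Let k : R := #|I|%:R.

Let k_gt0 : 0 < k. Proof. by rewrite ltr0n. Qed.

(** Left convolution by the uniform probability on the indexed family [s]. *)
Definition average u : G -> R := k^-1 *: \sum_i ltrans (s i) u.

Lemma summable1_average u : summable1 u -> summable1 (average u).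
Proof.
move=> su; apply: summable1Z; elim/big_ind : _ => [||i _].
- exact: summable10.
- exact: summable1D.
- exact: summable1_ltrans.
Qed.

Lemma norm1_sum (u : I -> G -> R) : (forall i, summable1 (u i)) ->
  summable1 (\sum_i u i) /\ norm1 (\sum_i u i) <= \sum_i norm1 (u i).
Proof.
move=> su; elim/big_ind2 : _ => [|a b c e [sa ab] [sc ce]|i _].
- by rewrite norm10; split=> //; exact: summable10.
- split; first exact: summable1D.
  exact: le_trans (ler_norm1D sa sc) (lerD ab ce).
- by [].
Qed.

Lemma norm1_average u : summable1 u -> norm1 (average u) <= norm1 u.
Proof.
move=> su; have [ss ns] := norm1_sum (fun i => summable1_ltrans (s i) su).
rewrite norm1Z// ger0_norm ?invr_ge0 ?(ltW k_gt0)//.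
rewrite ler_pdivrMl//.
apply: le_trans ns _; under eq_bigr do rewrite norm1_ltrans.
by rewrite sumr_const mulr_natl.
Qed.

Lemma averageB u z : average (u - z) = average u - average z.
Proof.
rewrite /average -scalerBr; congr (_ *: _).
by rewrite -sumrB; apply: eq_bigr.
Qed.

(** The left-hand vector is the mean of the [k] displacements; the factor [k^-1 <= 1] is then
    dropped. *)
Lemma average_displacement z : summable1 z ->
  norm1 (average z - z) <= norm_family (displacement s z).
Proof.
move=> sz; have sd := summable_displacement s sz.
have -> : average z - z = k^-1 *: \sum_i displacement s z i.
  rewrite sumrB scalerBr sumr_const -scaler_nat scalerA mulVf ?gt_eqF//.
  by rewrite scale1r.
have [ss ns] := norm1_sum sd.
rewrite norm1Z// ger0_norm ?invr_ge0 ?(ltW k_gt0)//.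
have k1 : k^-1 <= 1 by rewrite invf_le1// ler1n.
apply: le_trans (ler_piMl (norm1_ge0 _) k1) ns.
Qed.

(** The [i]-th translate is one of the nonnegative terms that add up to [k * average u]. *)
Lemma ltrans_le_average u i x : (forall x, 0 <= u x) ->
  ltrans (s i) u x <= k * average u x.
Proof.
move=> u0; have -> : k * average u x = (k *: average u) x by [].
rewrite /average scalerA mulfV ?gt_eqF// scale1r fct_sumE (bigD1 i)//=.
by rewrite lerDl sumr_ge0// => j _; exact: u0.
Qed.

Section iterated_average.
Variable z : G -> R.
Hypothesis z_gt0 : forall x, 0 < z x.
Hypothesis z_summable : summable1 z.

Let v (n : nat) : G -> R := iter n average z.
Let e := norm_family (displacement s z).

Lemma iter_average_ge0 n x : 0 <= v n x.
Proof.
elim: n x => [|n IH] x; first exact/ltW/z_gt0.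
have -> : v n.+1 x = k^-1 * (\sum_i ltrans (s i) (v n)) x by [].
rewrite fct_sumE mulr_ge0 ?invr_ge0 ?(ltW k_gt0)//.
by apply: sumr_ge0 => i _; exact: IH.
Qed.

Lemma summable1_iter_average n : summable1 (v n).
Proof. by elim: n => // n; exact: summable1_average. Qed.

Lemma norm1_iter_average n : norm1 (v n) <= norm1 z.
Proof.
elim: n => // n; apply: le_trans.
exact/norm1_average/summable1_iter_average.
Qed.

(** Telescoping: since [average] does not increase the norm, each further step adds at most [e]. *)
Lemma norm1_iter_averageB n : norm1 (v n - z) <= n%:R * e.
Proof.
elim: n => [|n IH]; first by rewrite mul0r subrr norm10.
have sv := summable1_iter_average.
have -> : v n.+1 - z = average (v n - z) + (average z - z).
  by rewrite averageB addrA subrK.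
apply: le_trans (ler_norm1D _ _) _.
- exact/summable1_average/summable1B.
- by apply: summable1B => //; exact: summable1_average.
rewrite -natr1 mulrDl mul1r lerD//; last exact: average_displacement.
by apply: le_trans IH; apply: norm1_average; exact: summable1B.
Qed.

(** Passing from [v n] to [z], translating, and passing back costs [n * e], [e] and [n * e]. *)
Lemma norm1_ltrans_iter_average n i :
  norm1 (ltrans (s i) (v n) - v n) <= (2 * n%:R + 1) * e.
Proof.
have sv := summable1_iter_average n.
have svz : summable1 (v n - z) by exact: summable1B.
have -> : ltrans (s i) (v n) - v n =
    (ltrans (s i) (v n - z) + displacement s z i) - (v n - z).
  have -> : ltrans (s i) (v n - z) = ltrans (s i) (v n) - ltrans (s i) z by [].
  by rewrite /displacement addrA subrK opprB addrA subrK.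
have sl := summable1_ltrans (s i) svz.
have sd := summable_displacement s z_summable.
apply: le_trans (ler_norm1B _ svz) _; first exact: summable1D.
have := ler_norm1D sl (sd i); rewrite norm1_ltrans.
have := norm1_iter_averageB n.
have : norm1 (displacement s z i) <= e.
  rewrite /e /norm_family (bigD1 i)//= lerDl; apply: sumr_ge0 => j _.
  exact: norm1_ge0.
by lra.
Qed.

Local Open Scope ereal_scope.

(** The series is first taken in [\bar R], where nonnegative sums can be exchanged freely; [esum_wE]
    then shows that it is finite. *)
Let wE x := \esum_(n in setT) (geo R n * v n x)%:E.

Let term_ge0 n x : 0 <= (geo R n * v n x)%:E.
Proof. by rewrite lee_fin mulr_ge0 ?iter_average_ge0// ltW// geo_gt0. Qed.

Let esum_geo_norm (u : nat -> G -> R) : (forall n, summable1 (u n)) ->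
  \esum_(x in setT) \esum_(n in setT) (geo R n * `|u n x|)%:E =
  \esum_(n in setT) (geo R n * norm1 (u n))%:E.
Proof.
move=> su; rewrite esum_exchange; last first.
  by move=> x n; rewrite lee_fin mulr_ge0// ltW// geo_gt0.
apply: eq_esum => n _; rewrite EFinM -norm1E// -esumZl//.
  exact/ltW/geo_gt0.
Qed.

Let esum_wE : \esum_(x in setT) wE x <= (norm1 z)%:E.
Proof.
have -> : \esum_(x in setT) wE x =
    \esum_(n in setT) (geo R n * norm1 (v n))%:E.
  rewrite -esum_geo_norm; last exact: summable1_iter_average.
  apply: eq_esum => x _; apply: eq_esum => n _.
  by rewrite ger0_norm ?iter_average_ge0.
apply: (@le_trans _ _ (\esum_(n in setT) ((norm1 z)%:E * (geo R n)%:E))).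
  apply: le_esum => n _; rewrite -EFinM lee_fin mulrC ler_wpM2r//.
    exact/ltW/geo_gt0.
  exact: norm1_iter_average.
rewrite esumZl ?norm1_ge0//; last by move=> n; rewrite lee_fin ltW// geo_gt0.
rewrite -[leRHS]mule1; apply: lee_wpmul2l; last exact: esum_geo.
by rewrite lee_fin norm1_ge0.
Qed.

Definition geometric_average x : R := fine (wE x).

Lemma geometric_averageE x : wE x = (geometric_average x)%:E.
Proof.
rewrite fineK// ge0_fin_numE; last by apply: esum_ge0 => n _.
apply: le_lt_trans (ltry (norm1 z)); apply: le_trans esum_wE.
by apply: esum_ge_term => y; apply: esum_ge0 => n _.
Qed.

(** This is the term [n = 0] alone. It yields both positivity and a lower bound for the norm. *)
Lemma geometric_average_ge x : (2^-1 * z x <= geometric_average x)%R.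
Proof.
rewrite -lee_fin -geometric_averageE.
exact: (@esum_ge_term _ _ (fun n => (geo R n * v n x)%:E) 0%N
  (fun n => term_ge0 n x)).
Qed.

Lemma geometric_average_gt0 x : (0 < geometric_average x)%R.
Proof.
apply: lt_le_trans (geometric_average_ge x).
by rewrite mulr_gt0// invr_gt0.
Qed.

Lemma summable1_geometric_average : summable1 geometric_average.
Proof.
rewrite /summable1; apply: le_lt_trans (ltry (norm1 z)).
apply: le_trans esum_wE; apply: le_esum => x _.
by rewrite geometric_averageE ger0_norm// ltW// geometric_average_gt0.
Qed.

Lemma norm1_geometric_average : (2^-1 * norm1 z <= norm1 geometric_average)%R.
Proof.
have -> : (2^-1 * norm1 z = norm1 (2^-1 *: z))%R by rewrite norm1Z// ger0_norm.
apply: (le_norm1 _ summable1_geometric_average).2 => x.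
rewrite !ger0_norm ?geometric_average_ge//.
  exact/ltW/geometric_average_gt0.
by rewrite mulr_ge0// ltW.
Qed.

(** A translate of [v n] is at most [k * v n.+1], and [geo n = 2 * geo n.+1]; the shifted series is
    then bounded by the whole one. *)
Lemma geometric_average_quasi_invariant i x :
  (ltrans (s i) geometric_average x <= 2 * k * geometric_average x)%R.
Proof.
rewrite -lee_fin EFinM -!geometric_averageE -esumZl//; last first.
  by rewrite mulr_ge0// ltW.
apply: (@le_trans _ _
    (\esum_(n in setT) ((2 * k)%:E * (geo R n.+1 * v n.+1 x)%:E))).
  apply: le_esum => n _; rewrite -EFinM lee_fin (geoS R n).
  rewrite (_ : 2 * k * _ = 2 * geo R n.+1 * (k * v n.+1 x))%R; last by ring.
  rewrite ler_wpM2l//; first by rewrite mulr_ge0// ltW// geo_gt0.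
  exact: (ltrans_le_average i x (iter_average_ge0 n)).
apply: (@le_esum_inj _ _ _ succn
  (fun n => (2 * k)%:E * (geo R n * v n x)%:E)); first exact: succn_inj.
by move=> n; rewrite mule_ge0// lee_fin mulr_ge0// ltW.
Qed.

Lemma geometric_average_almost_invariant i :
  (norm1 (ltrans (s i) geometric_average - geometric_average) <= 3 * e)%R.
Proof.
have sw := summable1_geometric_average.
rewrite -lee_fin -norm1E; last first.
  by apply: summable1B => //; exact: summable1_ltrans.
pose u n := (ltrans (s i) (v n) - v n)%R.
have su n : summable1 (u n).
  have sv := summable1_iter_average n.
  by apply: summable1B => //; exact: summable1_ltrans.
have geo_ge0 n : (0 <= geo R n)%R by exact/ltW/geo_gt0.
apply: (@le_trans _ _
    (\esum_(x in setT) \esum_(n in setT) (geo R n * `|u n x|)%:E)); last first.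
  rewrite esum_geo_norm//.
  apply: (@le_trans _ _
      (\esum_(n in setT) (e%:E * (geo R n * (2 * n%:R + 1))%:E))).
    apply: le_esum => n _; rewrite -EFinM lee_fin (mulrCA e) (mulrC e).
    by rewrite ler_wpM2l// norm1_ltrans_iter_average.
  have e0 : (0 <= e)%R by apply: sumr_ge0 => j _; exact: norm1_ge0.
  rewrite esumZl//; last by move=> n; rewrite lee_fin mulr_ge0.
  by rewrite EFinM muleC lee_wpmul2r ?lee_fin// esum_geo_odd.
apply: le_esum => x _.
have D_ge0 n : 0 <= (geo R n * `|u n x|)%:E by rewrite lee_fin mulr_ge0.
(* The two series are compared by adding the sum of absolute differences on either side, which
   avoids subtraction in [\bar R]. *)
have le1 : wE ((s i)^-1 * x)%g <=
    wE x + \esum_(n in setT) (geo R n * `|u n x|)%:E.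
  rewrite -esumD//; apply: le_esum => n _; rewrite -EFinD lee_fin -mulrDr.
  rewrite ler_wpM2l// -lerBlDl; exact: ler_norm.
have le2 : wE x <=
    wE ((s i)^-1 * x)%g + \esum_(n in setT) (geo R n * `|u n x|)%:E.
  rewrite -esumD//; apply: le_esum => n _; rewrite -EFinD lee_fin -mulrDr.
  rewrite ler_wpM2l// -lerBlDl -normrN.
  by apply: le_trans (ler_norm _); rewrite opprB.
move: le1 le2; rewrite !geometric_averageE.
case: (\esum_(n in setT) _) => [r| |]; rewrite ?leey//= -!EFinD !lee_fin.
move=> le1 le2.
rewrite (_ : (_ - _)%R x =
  (geometric_average ((s i)^-1 * x)%g - geometric_average x)%R)// ler_norml.
by apply/andP; split; lra.
Qed.

End iterated_average.

Lemma almost_invariant_weight (d : R) :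
  countable [set: G] -> amenable R G -> 0 < d -> exists w : G -> R,
  [/\ forall x, 0 < w x, summable1 w,
    forall i x, ltrans (s i) w x <= 2 * k * w x &
    forall i, norm1 (ltrans (s i) w - w) <= d * norm1 w].
Proof.
move=> cG amG d0.
(* In [d / 6], a factor 3 absorbs the constant of the displacement bound and a factor 2 absorbs
   [norm1 z <= 2 * norm1 w]. *)
have [z [z0 sz dz]] := reiter_pos cG amG (divr_gt0 d0 (ltr0n R 6)).
exists (geometric_average z); split.
- exact: geometric_average_gt0.
- exact: summable1_geometric_average.
- exact: geometric_average_quasi_invariant.
- move=> i; apply: le_trans (geometric_average_almost_invariant z0 sz i) _.
  have := norm1_geometric_average z0 sz.
  move: dz; rewrite mulrAC ltr_pdivlMr// => dz.
  by rewrite -(ler_pM2l d0) => h; lra.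
Qed.

End almost_invariant_weight.

(** * Probability measures from positive weights *)

Section weight_measure.
Variables (R : realType) (G : groupType) (w : G -> R).
Local Open Scope ereal_scope.

(** The absolute value makes the measure instance unconditional, and the total mass is literally the
    sum defining [norm1 w]. *)
Definition weight_measure (A : set (discrete_group G)) : \bar R :=
  \esum_(x in A) `|w x|%:E.

Let weight_measure0 : weight_measure set0 = 0.
Proof. exact: esum_set0. Qed.

Let weight_measure_ge0 A : 0 <= weight_measure A.
Proof. by apply: esum_ge0 => x _; rewrite lee_fin. Qed.

Let weight_measure_sigma_additive : semi_sigma_additive weight_measure.
Proof.
move=> F mF tF mUF; rewrite /weight_measure nneseries_sum_bigcup//.
apply: is_cvg_nneseries => n _ _; exact: weight_measure_ge0.
Qed.

HB.instance Definition _ := isMeasure.Build _ _ _ weight_measure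
  weight_measure0 weight_measure_ge0 weight_measure_sigma_additive.

Lemma probability_of_weight : (forall x, 0 < w x)%R -> summable1 w ->
  exists eta : probability (discrete_group G) R,
    forall x : discrete_group G, eta [set x] = (w x / norm1 w)%:E.
Proof.
(* The Dirac mass is the fallback of [mnormalize] for total mass 0 or [+oo]; both are excluded by
   [w1] and [wT]. *)
move=> w0 sw; exists (mnormalize weight_measure (dirac point)) => x.
have wT : weight_measure setT = (norm1 w)%:E by rewrite /weight_measure norm1E.
have w1 : (0 < norm1 w)%R.
  by apply: (@norm1_gt0 _ _ _ x) => //; rewrite gt_eqF.
rewrite /= /mnormalize /= wT eqe gt_eqF//=.
by rewrite /weight_measure esum_set1 ?lee_fin// gtr0_norm.
Qed.

End weight_measure.

(** * Kullback-Leibler divergence on a countable discrete group *)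

Section discrete_DKL.
Variables (R : realType) (G : groupType).
Hypothesis cG : countable [set: G].
Local Open Scope ereal_scope.
Local Notation T := (discrete_group G).

Lemma integral_point (mu : {measure set T -> \bar R}) (f : T -> \bar R) x :
  \int[mu]_(y in [set x]) f y = f x * mu [set x].
Proof.
rewrite -[RHS]integral_cst//; apply: eq_integral => y.
by rewrite inE => ->.
Qed.

(** The group is the disjoint union of the fibres of an injection into [nat], each of which is empty
    or a singleton. *)
Lemma integral_discrete (mu : {measure set T -> \bar R}) (f : T -> \bar R) :
  (forall x, 0 <= f x) ->
  \int[mu]_x f x = \esum_(x in [set: T]) (f x * mu [set x]).
Proof.
move=> f0; have /countable_injP[e inje] := cG.
pose F n : set T := [set x | e x = n].
have FT : \bigcup_n F n = setT by apply/seteqP; split=> // x _; exists (e x).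
have tF : trivIset setT F by move=> i j _ _ [x [<- <-]].
rewrite -FT ge0_integral_bigcup// nneseries_sum_bigcup//; last first.
  by move=> x; rewrite mule_ge0.
apply: eq_eseriesr => n _.
have [->|/set0P[x Fx]] := eqVneq (F n) set0.
  by rewrite integral_set0 esum_set0.
have -> : F n = [set x].
  apply/seteqP; split=> [y Fy|y ->//] /=; apply: inje; rewrite ?in_setT//.
  by rewrite Fy Fx.
by rewrite integral_point esum_set1// mule_ge0.
Qed.

(** Serves for integrands of either sign, such as [- lne rn]. All functions are measurable here, so
    comparing positive and negative parts suffices. *)
Lemma le_integral_discrete (mu : {measure set T -> \bar R})
  (f g : T -> \bar R) : (forall x, f x <= g x) ->
  \int[mu]_x f x <= \int[mu]_x g x.
Proof.
move=> fg; rewrite integralE [leRHS]integralE leeB//.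
  apply: ge0_le_integral => // x _.
  by apply: (@funepos_le _ _ setT f g) => [y _|]; rewrite ?in_setT.
apply: ge0_le_integral => // x _.
by apply: (@funeneg_le _ _ setT f g) => [y _|]; rewrite ?in_setT.
Qed.

Variables m nu : probability T R.
Hypothesis m_gt0 : fully_supported m.
Hypothesis nu_gt0 : fully_supported nu.

Let a x : R := fine (m [set x]).
Let b x : R := fine (nu [set x]).

Let mE x : m [set x] = (a x)%:E.
Proof. by rewrite fineK// fin_num_measure. Qed.

Let nuE x : nu [set x] = (b x)%:E.
Proof. by rewrite fineK// fin_num_measure. Qed.

Let a_gt0 x : (0 < a x)%R. Proof. by rewrite -lte_fin -mE. Qed.

Let b_gt0 x : (0 < b x)%R. Proof. by rewrite -lte_fin -nuE. Qed.

(** A null set of [m] contains no point, hence is empty. *)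
Lemma fully_supported_dominates : charge_of_finite_measure nu `<< m.
Proof.
apply/null_content_dominatesP => A _ mA0.
have [->|/set0P[x Ax]] := eqVneq A set0; first exact: measure0.
have := m_gt0 x; rewrite ltNge -mA0 => /negP[].
by apply: le_measure; rewrite ?inE// => y ->.
Qed.

Local Notation rn := (Radon_Nikodym (charge_of_finite_measure nu) m).

(** The derivative is determined up to null sets only, but every point has positive mass, so
    integrating over singletons fixes it everywhere. *)
Let rnE x : rn x = (b x / a x)%:E.
Proof.
have dom := fully_supported_dominates.
have E : (b x)%:E = rn x * (a x)%:E.
  by rewrite -nuE -mE -integral_point; exact: (Radon_Nikodym_integral dom).
move: E; have /fineK <- := Radon_Nikodym_fin_num x dom.
by rewrite -EFinM => -[->]; rewrite mulfK ?gt_eqF.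
Qed.

Let lne_rn x : - lne (rn x) = (ln (a x / b x))%:E.
Proof.
have r0 : (0 < b x / a x)%R by rewrite divr_gt0.
by rewrite rnE lne_EFin// -EFinN -lnV// invf_div.
Qed.

(** Integrating [1 - t <= - ln t] at [t = rn x] against [m] gives the bound, the left side having
    integral [1 - 1]. *)
Lemma DKL_ge0 : 0 <= DKL m nu.
Proof.
have dom := fully_supported_dominates.
have irn := Radon_Nikodym_integrable dom.
have -> : 0 = \int[m]_x (cst 1 \- rn) x.
  rewrite integralB//; last exact: finite_measure_integrable_cst.
  have <- : nu setT = \int[m]_x rn x by exact: (Radon_Nikodym_integral dom).
  rewrite integral_cst// mul1e (probability_setT nu) -[LHS](@subee _ 1)//.
  by congr (_ - _); exact/esym/(probability_setT m).
apply: le_integral_discrete => x.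
rewrite lne_rn rnE -[X in X <= _]/((1 - b x / a x)%:E) lee_fin.
have r0 : (0 < b x / a x)%R by rewrite divr_gt0.
have := @le_ln1Dx _ (b x / a x - 1)%R ltac:(by rewrite ltrBrDr addNr).
rewrite [X in ln X]addrC subrK -[in ln _]invf_div lnV ?posrE ?divr_gt0//.
by lra.
Qed.

(** [D] dominates the excess of [m] over [nu]. Each term [(a / b - 1) * a] equals
    [(a - b) * (a / b)], whose factors are at most [D] and [C]. *)
Lemma DKL_le (C : R) (D : G -> R) : (0 <= C)%R -> (forall x, 0 <= D x)%R ->
  (forall x, m [set x] <= C%:E * nu [set x]) ->
  (forall x, m [set x] <= nu [set x] + (D x)%:E) ->
  DKL m nu <= C%:E * \esum_(x in [set: G]) (D x)%:E.
Proof.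
move=> C0 D0 mC mD.
(* Truncation at 0 makes the integrand nonnegative, so that its integral is an unordered sum. *)
pose h x : R := Num.max (a x / b x - 1)%R 0%R.
apply: (@le_trans _ _ (\int[m]_x (h x)%:E)).
  apply: le_integral_discrete => x; rewrite lne_rn lee_fin le_max.
  apply/orP; left.
  have r0 : (0 < a x / b x)%R by rewrite divr_gt0.
  have := @le_ln1Dx _ (a x / b x - 1)%R ltac:(by rewrite ltrBrDr addNr).
  by rewrite [X in ln X]addrC subrK.
have h0 x : (0 <= h x)%R by rewrite le_max lexx orbT.
rewrite integral_discrete// -esumZl//; apply: le_esum => x _.
have -> : (h x)%:E * m [set x] = (h x * a x)%:E by rewrite EFinM -mE.
rewrite -EFinM lee_fin.
have := mC x; have := mD x; rewrite mE nuE -EFinM -EFinD !lee_fin => ab aC.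
rewrite /h maxEle; case: ifP => _; first by rewrite mul0r mulr_ge0.
have -> : ((a x / b x - 1) * a x = (a x - b x) * (a x / b x))%R.
  by field; rewrite gt_eqF.
apply: (@le_trans _ _ (D x * (a x / b x))%R).
  by rewrite ler_wpM2r ?lerBlDl// divr_ge0 ?ltW.
by rewrite mulrC ler_wpM2r// ler_pdivrMr.
Qed.

End discrete_DKL.

(** * KL-almost invariant measures and vanishing of the entropy infimum *)

Section furstenberg.
Variables (R : realType) (G : groupType).
Hypothesis cG : countable [set: G].
Local Open Scope ereal_scope.
Implicit Types (lambda eta : probability (discrete_group G) R).

Lemma translate_point eta (g x : discrete_group G) :
  translate g eta [set x] = eta [set (g^-1 * x)%g].
Proof.
rewrite /translate /distribution /= /pushforward; congr (eta _).
apply/seteqP; split=> y /=; first by move=> <-; rewrite mulKg.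
by move=> ->; rewrite /left_translation mulVKg.
Qed.

Lemma fully_supported_translate eta g :
  fully_supported eta -> fully_supported (translate g eta).
Proof. by move=> eta0 x; rewrite translate_point. Qed.

Lemma KL_almost_invariant (S : set G) (eps : R) :
  amenable R G -> finite_set S -> (0 < eps)%R ->
  exists eta, fully_supported eta /\
    forall g : G, S g -> DKL (translate g eta) eta < eps%:E.
Proof.
move=> amG finS eps0.
(* Adding the identity keeps the index type nonempty even when [S] is empty. *)
pose l : seq G := 1%g :: finmap.enum_fset (fset_set S).
pose s (i : 'I_(size l)) : G := nth 1%g l i.
have Sl g : S g -> exists i, s i = g.
  move=> Sg; have gl : g \in l by rewrite inE in_fset_set// mem_set// orbT.
  have := gl; rewrite -index_mem => lt; exists (Ordinal lt); exact: nth_index.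
have card0 : (0 < #|'I_(size l)|)%N by rewrite card_ord.
pose C : R := (2 * #|'I_(size l)|%:R)%R.
have C0 : (0 < C)%R by rewrite mulr_gt0// ltr0n.
(* [C] is the quasi-invariance constant; displacement [eps / (2 * C)] bounds the divergence by
   [eps / 2], leaving room for a strict inequality. *)
have d0 : (0 < eps / (2 * C))%R by rewrite divr_gt0// mulr_gt0.
have [w [w0 sw wC wd]] := almost_invariant_weight s card0 cG amG d0.
have [eta etaE] := probability_of_weight w0 sw.
have N0 : (0 < norm1 w)%R.
  by apply: (@norm1_gt0 _ _ _ 1%g) => //; rewrite gt_eqF.
have eta0 : fully_supported eta.
  by move=> x; rewrite etaE lte_fin divr_gt0.
exists eta; split=> // g /Sl[i sig].
pose D x : R := (`|(ltrans (s i) w - w)%R x| / norm1 w)%R.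
have etag x : translate g eta [set x] = (ltrans (s i) w x / norm1 w)%:E.
  by rewrite translate_point etaE /ltrans sig.
have sD : summable1 (ltrans (s i) w - w)%R.
  by apply: summable1B => //; exact: summable1_ltrans.
apply: (@le_lt_trans _ _ (C%:E * \esum_(x in [set: G]) (D x)%:E)).
  apply: DKL_le => //.
  - exact: fully_supported_translate.
  - exact: ltW.
  - by move=> x; rewrite divr_ge0// ltW.
  - by move=> x; rewrite etag etaE -EFinM lee_fin mulrA ler_pM2r ?invr_gt0.
  - move=> x; rewrite etag etaE -EFinD lee_fin -mulrDl ler_pM2r ?invr_gt0//.
    by rewrite -lerBlDl; exact: ler_norm.
have -> : \esum_(x in [set: G]) (D x)%:E =
    ((norm1 w)^-1 * norm1 (ltrans (s i) w - w))%:E.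
  rewrite EFinM -norm1E// -esumZl// ?invr_ge0 ?norm1_ge0//.
  by apply: eq_esum => x _; rewrite -EFinM mulrC.
rewrite -EFinM lte_fin.
apply: (@le_lt_trans _ _ (eps / 2)%R); last first.
  by rewrite ltr_pdivrMr// ltr_pMr// ltr1n.
have -> : (eps / 2 = C * (eps / (2 * C)))%R by field; rewrite gt_eqF.
by rewrite ler_pM2l// ler_pdivrMl// mulrC.
Qed.

Lemma furstenberg_entropy_ge0 lambda eta :
  fully_supported eta -> 0 <= furstenberg_entropy lambda eta.
Proof.
move=> eta0; apply: esum_ge0 => g _; apply: mule_ge0 => //.
by apply: DKL_ge0 => //; exact: fully_supported_translate.
Qed.

Lemma esum_point_le lambda :
  \esum_(g in [set: discrete_group G]) lambda [set g] <= 1.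
Proof.
rewrite -(probability_setT lambda).
have -> : lambda setT = \int[lambda]_x (cst 1 x).
  by rewrite integral_cst// mul1e.
rewrite integral_discrete//.
by under [leRHS]eq_esum do rewrite mul1e.
Qed.

Lemma furstenberg_entropy_le lambda eta (c : R) : (0 <= c)%R ->
  (forall g, lambda [set g] != 0 -> DKL (translate g eta) eta <= c%:E) ->
  furstenberg_entropy lambda eta <= c%:E.
Proof.
move=> c0 le_c.
apply: (@le_trans _ _
    (\esum_(g in [set: discrete_group G]) (c%:E * lambda [set g]))).
  apply: le_esum => g _; rewrite [leRHS]muleC.
  have [->|l0] := eqVneq (lambda [set g]) 0; first by rewrite !mul0e.
  by apply: lee_wpmul2l => //; exact: le_c.
rewrite esumZl// -[leRHS]mule1; apply: lee_wpmul2l; rewrite ?lee_fin//.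
exact: esum_point_le.
Qed.

Lemma inf_furstenberg_entropy_eq0 lambda :
  finitely_supported lambda -> amenable R G ->
  inf_furstenberg_entropy lambda = 0.
Proof.
move=> finl amG; apply/eqP; rewrite eq_le; apply/andP; split; last first.
  apply: le_ereal_inf_tmp => _ [eta eta0 <-].
  exact: furstenberg_entropy_ge0.
apply/lee_addgt0Pr => eps eps0; rewrite add0e.
(* The finite set is the support of [lambda]: every divergence that contributes is below [eps], and
   the masses of [lambda] sum to at most 1. *)
have [eta [eta0 le_eps]] := KL_almost_invariant amG finl eps0.
apply: (@le_trans _ _ (furstenberg_entropy lambda eta)).
  by apply: ereal_inf_lbound; exists eta.
by apply: furstenberg_entropy_le => [|g l0]; [exact: ltW|exact/ltW/le_eps].
Qed.

End furstenberg.

Unset Implicit Arguments.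

Theorem theoremA (R : realType) (G : groupType)
    (lambda : probability (discrete_group G) R) :
  countable [set: G] ->
  finitely_supported lambda ->
  amenable R G ->
  inf_furstenberg_entropy lambda = 0%E /\
  (forall (S : set G) (eps : R), finite_set S -> 0 < eps ->
    exists eta : probability (discrete_group G) R,
      fully_supported eta /\
      forall g : G, S g -> (DKL (translate g eta) eta < eps%:E)%E).
Proof.
move=> cG finl amG; split; first exact: inf_furstenberg_entropy_eq0.
by move=> S eps; exact: KL_almost_invariant.
Qed.
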